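(* Let $\{g_1,\ldots,g_t\}$ be a monic short reduced Gröbner basis of an ideal $\mathfrak{a}$ in $\mathbb{Z}[x_1,\ldots,x_n]$ such that $\mathbb{Z}[x_1,\ldots,x_n]/\mathfrak{a}\cong\mathbb{Z}^N$ (as $\mathbb{Z}$-modules) for some $N\in\mathbb{N}$. All ideals in $\mathbb{Z}[x_1,\ldots,x_n]/\mathfrak{a}$ are full rank lattices if and only if $\mathfrak{a}$ is a prime ideal.
   Context: $\mathbb{N}$ denotes the set of positive integers including zero. Via the isomorphism $\mathbb{Z}[x_1,\ldots,x_n]/\mathfrak{a}\cong\mathbb{Z}^N$, ideals of the residue class ring are identified with subgroups of $\mathbb{Z}^N$, i.e. integer lattices; a lattice in $\mathbb{Z}^N$ is full rank if its rank equals $N$. Short reduced Gröbner basis over $\mathbb{Z}$: fix a monomial order, with leading monomial $\mathrm{lm}$, leading coefficient $\mathrm{lc}$ and leading term $\mathrm{lt}=\mathrm{lc}\cdot\mathrm{lm}$. A finite set $G\subseteq\mathfrak{a}$ is a Gröbner basis of $\mathfrak{a}$ if the ideal generated by $\{\mathrm{lt}(g):g\in G\}$ equals the ideal generated by $\{\mathrm{lt}(f):f\in\mathfrak{a}\setminus\{0\}\}$. For a monomial $x^\alpha$ the leading coefficient ideal is $I_{x^\alpha}=\langle \mathrm{lc}(g): g\in G,\ \mathrm{lm}(g)\mid x^\alpha\rangle\subseteq\mathbb{Z}$. A short reduced Gröbner basis is a reduced Gröbner basis (in the sense of Pauer's reduced Gröbner bases over rings) in which, for each $x^\alpha\in\mathrm{lm}(G)$,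 the length of the generating set of $I_{x^\alpha}$ is minimal; over $\mathbb{Z}$ this means that the generator of the leading coefficient ideal is taken to be the gcd of all its generators. A basis is monic if the leading coefficients of all its elements equal $1$.
   Formalization: ''All ideals'' is read as all nonzero ideals of the quotient (the zero ideal has rank 0, so the claim fails for every prime ideal when N > 0), and the ideal 𝔞 is assumed proper (for 𝔞 = (1), N = 0, the claim fails). *)

(* Defs.v *)
From HB Require Import structures.
From mathcomp Require Import all_boot all_order all_algebra.
From mathcomp Require Import generic_quotient ring_quotient.
From mathcomp.multinomials Require Import mpoly.

Set Implicit Arguments.
Unset Strict Implicit.
Unset Printing Implicit Defensive.

Import Order.TTheory GRing.Theory Num.Theory.
Local Open Scope ring_scope.

(* Unlike [idealr_closed] of ring_quotient, which forces [1 \notin S], this    *)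
(* allows the unit ideal.                                                      *)
Definition is_ideal (R : comNzRingType) (J : R -> Prop) : Prop :=
  [/\ J 0,
      forall x y, J x -> J y -> J (x + y)
    & forall r x, J x -> J (r * x)].

Definition ideal_gen (R : comNzRingType) (S : R -> Prop) (x : R) : Prop :=
  exists2 s : seq (R * R),
    (forall p, p \in s -> S p.2) & x = \sum_(p <- s) p.1 * p.2.

Section Groebner.

Variable n : nat.
Implicit Types (le : rel 'X_{1..n}) (p g : {mpoly int[n]}).
Implicit Types (G : seq {mpoly int[n]}) (a : {pred {mpoly int[n]}}).

Definition monomial_order le : Prop :=
  [/\ total le, antisymmetric le, transitive le,
      forall m, le 0%MM m
    & forall m m1 m2, le m1 m2 -> le (m1 + m)%MM (m2 + m)%MM].

(* [mlead] of mpoly is tied to degrevlex; these are relative to [le].  The     *)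
(* leading monomial of 0 is 0%MM, its leading coefficient and term are 0.      *)
Definition lmon le p : 'X_{1..n} := last 0%MM (sort le (msupp p)).
Definition lcoef le p : int := p@_(lmon le p).
Definition lterm le p : {mpoly int[n]} := lcoef le p *: 'X_[lmon le p].

Definition groebner_basis le a G : Prop :=
  [/\ uniq G, {subset G <= a}
    & forall x,
        ideal_gen (fun t => exists2 g, g \in G & t = lterm le g) x <->
        ideal_gen (fun t => exists2 f, f \in a /\ f != 0 & t = lterm le f) x].

Definition lc_ideal le G (m : 'X_{1..n}) : int -> Prop :=
  ideal_gen (fun c => exists2 g,
    g \in G /\ (lmon le g <= m)%MM & c = lcoef le g).

(* The nonnegative generator of [lc_ideal le G m]. *)
Definition lc_gcd le G (m : 'X_{1..n}) : int :=
  \big[gcdz/0]_(g <- G | (lmon le g <= m)%MM) lcoef le g.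

(* Pauer's reducedness over Z, with {0, ..., d - 1} as the chosen coset        *)
(* representatives of Z/dZ for d > 0, and all of Z for d = 0 ([(c %% 0)%Z] is  *)
(* [c]).  The first condition says that no leading term lies in the ideal      *)
(* generated by the others.                                                    *)
Definition reduced_groebner_basis le a G : Prop :=
  [/\ groebner_basis le a G,
      forall g, g \in G -> ~ lc_ideal le (rem g G) (lmon le g) (lcoef le g)
    & forall g m, g \in G -> m != lmon le g ->
        (g@_m %% lc_gcd le G m)%Z = g@_m].

(* Over Z every leading coefficient ideal has a generating set of length at    *)
(* most one, namely the gcd of its generators.                                 *)
Definition short_reduced_groebner_basis le a G : Prop :=
  reduced_groebner_basis le a G /\
  forall g, g \in G -> lcoef le g = lc_gcd le G (lmon le g).

Definition monic_basis le G : Prop := forall g, g \in G -> lcoef le g = 1.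

End Groebner.

Section Lattice.

Variable N : nat.
Implicit Type L : 'rV[int]_N -> Prop.

Definition lin_indep r (B : 'M[int]_(r, N)) : Prop :=
  forall u : 'rV[int]_r, u *m B = 0 -> u = 0.

(* The rank of a subgroup of Z^N: the maximal number of Z-linearly independent *)
(* elements.                                                                   *)
Definition lattice_rank L (r : nat) : Prop :=
  (exists2 B : 'M[int]_(r, N), (forall i, L (row i B)) & lin_indep B) /\
  (forall s (B : 'M[int]_(s, N)),
     (forall i, L (row i B)) -> lin_indep B -> (s <= r)%N).

Definition full_rank L : Prop := lattice_rank L N.

End Lattice.

Definition image_lattice (Q : Type) N (phi : Q -> 'rV[int]_N) (J : Q -> Prop) :
  'rV[int]_N -> Prop := fun v => exists2 x, J x & v = phi x.

(* Main.v *)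
(* In a ring [R] isomorphic to Z^N as a group, full rank of an ideal [J] means *)
(* that [J] contains [N] independent vectors.  If [R] is a domain and [x] is a *)
(* nonzero element of [J], multiplication by [x] is injective, so [x] times a  *)
(* basis of [R] is such a family.  Conversely, if [u * v = 0] with [u <> 0],   *)
(* then the principal ideal [R u] has full rank, so by Cramer's rule it        *)
(* contains a nonzero integer [d]; hence [d v = 0], and [v = 0] because Z^N    *)
(* is torsion free.                                                            *)
Require Import Defs.
From HB Require Import structures.
From mathcomp Require Import all_boot all_order all_algebra.
From mathcomp Require Import zify.
From mathcomp Require Import generic_quotient ring_quotient.
From mathcomp.multinomials Require Import mpoly.

Set Implicit Arguments.
Unset Strict Implicit.
Unset Printing Implicit Defensive.

Import Order.TTheory GRing.Theory Num.Theory.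
Local Open Scope ring_scope.

(** If [N < s], padding [B] with zero columns gives a singular square matrix, so some nonzero
    integer row vector kills it, hence kills [B]. *)
Lemma lin_indep_leq N s (B : 'M[int]_(s, N)) : lin_indep B -> (s <= N)%N.
Proof.
move=> Bfree; rewrite leqNgt; apply/negP => ltNs.
have eqs : (N + (s - N))%N = s by rewrite subnKC // ltnW.
pose C : 'M[int]_s := castmx (erefl s, eqs) (row_mx B 0).
have /det0P[v nzv] : \det C == 0.
  (* The last column, of index [s - 1], is a padding column. *)
  have lt0 : (N + (s - N - 1) < s)%N by lia.
  pose j0 : 'I_s := Ordinal lt0.
  rewrite -det_tr (expand_det_row _ j0) big1 // => i _.
  rewrite !mxE castmxE /= mxE cast_ord_id.
  case: splitP => [k /= eqk | k _]; last by rewrite mxE mul0r.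
  by have := ltn_ord k; rewrite -eqk; lia.
move=> vC0; move/eqP: nzv; apply; apply: Bfree.
have: v *m row_mx B (0 : 'M_(s, s - N)) = 0.
  apply/rowP => k; move/rowP/(_ (cast_ord eqs k)): vC0.
  rewrite !mxE => vC0; rewrite -[RHS]vC0; apply: eq_bigr => i _.
  by rewrite castmxE /= cast_ord_id cast_ordK.
by rewrite mul_mx_row => /(congr1 lsubmx); rewrite row_mxKl linear0.
Qed.

Lemma lin_indep_det_neq0 N (B : 'M[int]_N) : lin_indep B -> \det B != 0.
Proof.
by move=> Bfree; apply/det0P => -[v nzv /Bfree v0]; rewrite v0 eqxx in nzv.
Qed.

Section FreeRing.

Variables (R : comNzRingType) (N : nat) (phi : {additive R -> 'rV[int]_N}).
Hypothesis phi_bij : bijective phi.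

Let phi_inj : injective phi := bij_inj phi_bij.

Let phi_eq0 x : phi x = 0 -> x = 0.
Proof. by move=> phix0; apply: phi_inj; rewrite phix0 raddf0. Qed.

Lemma mulmx_image_sum m (x : 'I_m -> R) (B : 'M[int]_(m, N)) (u : 'rV[int]_m) :
  (forall i, row i B = phi (x i)) -> u *m B = phi (\sum_i x i *~ u 0 i).
Proof.
move=> Bx; rewrite mulmx_sum_row raddf_sum; apply: eq_bigr => i _.
by rewrite Bx raddfMz -scaler_int intz.
Qed.

Lemma full_rank_ideal_of_domain (J : R -> Prop) :
  (forall x y : R, x * y = 0 -> x = 0 \/ y = 0) ->
  is_ideal J -> (exists2 x, J x & x <> 0) -> full_rank (image_lattice phi J).
Proof.
move=> Rdom [_ _ JM] [x Jx nzx]; have [psi _ psiK] := phi_bij.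
split; last by move=> s B _; apply: lin_indep_leq.
pose B : 'M[int]_N := \matrix_i phi (psi 'e_i * x).
have BE i : row i B = phi (psi 'e_i * x) by rewrite rowK.
exists B => [i | u]; first by exists (psi 'e_i * x); [apply: JM | apply: BE].
rewrite (mulmx_image_sum _ BE) => /phi_eq0.
under eq_bigr => i _ do rewrite -mulrzAl.
rewrite -mulr_suml => /Rdom[sum0 | //].
(* The [psi 'e_i] are a Z-basis of [R], and [u] is the coordinate vector of the vanishing sum. *)
rewrite -[u]mulmx1 (@mulmx_image_sum _ (fun i => psi 'e_i)) ?sum0 ?raddf0 //.
by move=> i; rewrite row1 psiK.
Qed.

Lemma domain_of_full_rank_ideals :
  (forall J : R -> Prop, is_ideal J -> (exists2 x, J x & x <> 0) ->
     full_rank (image_lattice phi J)) ->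
  forall x y : R, x * y = 0 -> x = 0 \/ y = 0.
Proof.
move=> full x y xy0; have [-> | /eqP nzx] := eqVneq x 0; [by left | right].
pose J z := exists r, z = r * x.
have [||[B JB Bfree] _] := full J.
- split=> [|_ _ [r ->] [s ->] | r _ [s ->]].
  + by exists 0; rewrite mul0r.
  + by exists (r + s); rewrite mulrDl.
  + by exists (r * s); rewrite mulrA.
- by exists x => //; exists 1; rewrite mul1r.
have [psi phiK psiK] := phi_bij.
have yB i : psi (row i B) * y = 0.
  by have [_ [r ->] ->] := JB i; rewrite phiK -mulrA xy0 mulr0.
(* The adjugate writes the integer [\det B] of [R] as a combination of the rows of [B], all killed
   by [y]. *)
have : phi (1 *~ \det B) = (phi 1 *m \adj B) *m B.
  by rewrite -mulmxA mul_adj_mx mul_mx_scalar raddfMz -scaler_int intz.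
rewrite (@mulmx_image_sum _ (fun i => psi (row i B))) => [|i]; last first.
  by rewrite psiK.
move/phi_inj/(congr1 ( *%R^~ y)); rewrite mulr_suml big1 => [|i _]; last first.
  by rewrite mulrzAl yB mul0rz.
rewrite mulrzAl mul1r => /(congr1 phi).
rewrite raddf0 raddfMz -scaler_int intz => /eqP.
rewrite scalemx_eq0 (negPf (lin_indep_det_neq0 Bfree)) => /eqP.
exact: phi_eq0.
Qed.

End FreeRing.

Lemma quot_domain_prime (R : comNzRingType) (a : idealr R) :
  (forall x y : {ideal_quot a}, x * y = 0 -> x = 0 \/ y = 0) <->
  prime_idealr_closed a.
Proof.
have pi0 x : (\pi_{ideal_quot a} x == 0)%qT = (x \in a).
  by rewrite -[x in RHS]subr0 Quotient.idealrBE rmorph0.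
split=> [dom u v | prime x y].
  rewrite -!pi0 rmorphM => /eqP/dom[] ->; by rewrite eqxx ?orbT.
rewrite -[x]reprK -[y]reprK -rmorphM => /eqP; rewrite pi0.
by move=> /prime/orP[]; rewrite -pi0 => /eqP; [left | right].
Qed.

(* An [idealr] is proper by definition, which excludes exactly the case N = 0, *)
(* where the equivalence fails.  The zero ideal, which never has full rank     *)
(* when N > 0, is excluded from "all ideals".                                  *)
Theorem proposition4p8 (n : nat) (le : rel 'X_{1..n}) (hle : monomial_order le)
    (a : idealr {mpoly int[n]}) (G : seq {mpoly int[n]})
    (hG : short_reduced_groebner_basis le a G) (hmonic : monic_basis le G)
    (N : nat) (phi : {additive {ideal_quot a} -> 'rV[int]_N})
    (hphi : bijective phi) :
  (forall J : {ideal_quot a} -> Prop,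
     is_ideal J -> (exists2 x, J x & x <> 0) -> full_rank (image_lattice phi J))
  <-> prime_idealr_closed a.
Proof.
rewrite -quot_domain_prime; split; first exact: domain_of_full_rank_ideals.
by move=> dom J; apply: full_rank_ideal_of_domain.
Qed.
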